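(* Let $\mathfrak{g}$ be a finite dimensional Lie algebra over a field $k$ (of arbitrary characteristic) and let $M$ be a finite dimensional $\mathfrak{g}$-module. Suppose that $\sigma\in\mathfrak{g}$ is an ad-semisimple (adss) element, that $k$ contains the eigenvalues of $\operatorname{ad}\sigma$ (that is, of the action of $\sigma$ on $\mathfrak{g}$ and on $M$), and that $F\in C^n(\mathfrak{g},M)$ is an $n$-cocycle which is homogeneous of degree $r\in k$ with respect to the grading induced by $\sigma$. Then: 1. If $r\neq 0$, then $F$ is a coboundary. 2. If $r=0$ and $n\geq 1$, then the $(n-1)$-cochain $\iota_\sigma\cdot F$ is again a cocycle.
   Context: For a Lie algebra $\mathfrak{g}$ over $k$ and a $\mathfrak{g}$-module $M$, the action of $a\in\mathfrak{g}$ on $m\in M$ is written $[a,m]$. $C^n(\mathfrak{g},M)$ is the space of $k$-linear maps $\bigwedge^n\mathfrak{g}\to M$ (with $C^0(\mathfrak{g},M)=M$), and the Chevalley-Eilenberg coboundary $\delta:C^n\to C^{n+1}$ is $$(\delta F)(a_0,\dots,a_n)=\sum_{0\le i\le n}(-1)^i[a_i,F(\dots,\hat a_i,\dots)]+\sum_{0\le i<j\le n}(-1)^{i+j}F([a_i,a_j],\dots,\hat a_i,\dots,\hat a_j,\dots).$$ Cocycles are elements of $\ker\delta$; $n$-coboundaries are elements of $\delta(C^{n-1})$ (with $C^{-1}=0$). For $a\in\mathfrak{g}$ and $F\in C^n$, $n\ge1$, $\iota_a\cdot F\in C^{n-1}$ is defined by $(\iota_a\cdot F)(a_1,\dots,a_{n-1})=F(a,a_1,\dots,a_{n-1})$.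 An element $\sigma\in\mathfrak{g}$ is called ad-semisimple (adss) if it acts semisimply both on $\mathfrak{g}$ (by the adjoint action) and on $M$. When $k$ contains the eigenvalues of these actions, $\mathfrak{g}$ and $M$ are direct sums of eigenspaces $\mathfrak{g}_\lambda$, $M_\nu$ of $\sigma$ ($\lambda,\nu\in k$). A cochain $F\in C^n(\mathfrak{g},M)$ is homogeneous of degree $r\in k$ if $a_i\in\mathfrak{g}_{\lambda_i}$ for $i=1,\dots,n$ implies $F(a_1,\dots,a_n)\in M_{\lambda_1+\dots+\lambda_n+r}$. *)

(* Defs.v *)
From HB Require Import structures.
From mathcomp Require Import all_boot all_order all_algebra.

Set Implicit Arguments.
Unset Strict Implicit.
Unset Printing Implicit Defensive.

Import GRing.Theory passmx.
Local Open Scope ring_scope.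

(* [lie a a = 0] rather than antisymmetry: the characteristic may be 2. *)
HB.mixin Record isLieAlgebra (k : fieldType) g of GRing.Lmodule k g := {
  lie : g -> g -> g;
  lie_bilinear : bilinear_for *:%R *:%R lie;
  lie_alternating : forall a, lie a a = 0;
  lie_jacobi : forall a b c, lie a (lie b c) + lie b (lie c a) + lie c (lie a b) = 0
}.

#[short(type="lieAlgType")]
HB.structure Definition LieAlgebra (k : fieldType) :=
  {g of isLieAlgebra k g & GRing.Lmodule k g}.

#[short(type="finLieAlgType")]
HB.structure Definition FinLieAlgebra (k : fieldType) :=
  {g of isLieAlgebra k g & Vector k g}.

HB.mixin Record isLieModule (k : fieldType) (g : lieAlgType k) M
    of GRing.Lmodule k M := {
  act : g -> M -> M;
  act_bilinear : bilinear_for *:%R *:%R act;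
  act_lie : forall a b m, act (lie a b) m = act a (act b m) - act b (act a m)
}.

#[short(type="lieModType")]
HB.structure Definition LieModule (k : fieldType) (g : lieAlgType k) :=
  {M of isLieModule k g M & GRing.Lmodule k M}.

#[short(type="finLieModType")]
HB.structure Definition FinLieModule (k : fieldType) (g : lieAlgType k) :=
  {M of isLieModule k g M & Vector k M}.

HB.instance Definition _ (k : fieldType) (g : lieAlgType k) (a : g) :=
  GRing.isLinear.Build k g g *:%R (lie a) ((@lie_bilinear k g).2 a).

HB.instance Definition _ (k : fieldType) (g : lieAlgType k)
    (M : lieModType g) (a : g) :=
  GRing.isLinear.Build k M M *:%R (act a) ((@act_bilinear k g M).2 a).

(* Cochains: a linear map from the n-th exterior power of g to M is an
   alternating n-linear map, and these are the functions on n-tuples of elements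
   of g that satisfy [is_cochain]. For n = 0 there is exactly one argument
   tuple, so that 0-cochains are elements of M. *)

Definition set_arg (T : Type) n (a : {ffun 'I_n -> T}) (i : 'I_n) (x : T) :
    {ffun 'I_n -> T} :=
  [ffun j => if j == i then x else a j].

Definition cons_arg (T : Type) n (x : T) (a : {ffun 'I_n -> T}) :
    {ffun 'I_n.+1 -> T} :=
  [ffun j => if unlift ord0 j is Some j' then a j' else x].

(* [bump i j <= n] for all [j < n], so [inord] never truncates here. *)
Definition drop_arg (T : Type) n (i : nat) (a : {ffun 'I_n.+1 -> T}) :
    {ffun 'I_n -> T} :=
  [ffun j : 'I_n => a (inord (bump i j))].

Notation cochain g M n := ({ffun 'I_n -> g} -> M).

Definition is_cochain (k : fieldType) (g M : lmodType k) n
    (F : cochain g M n) : Prop :=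
  (forall (a : {ffun 'I_n -> g}) (i : 'I_n),
     linear (fun x => F (set_arg a i x))) /\
  (forall (a : {ffun 'I_n -> g}) (i j : 'I_n), i != j -> a i = a j -> F a = 0).

(* The second sum of the coboundary formula, which is empty for n = 0. For
   i < j, the argument a_j is deleted first, so that a_i keeps its index. *)
Definition coboundary_bracket (k : fieldType) (g : lieAlgType k)
    (M : lieModType g) n : cochain g M n -> cochain g M n.+1 :=
  match n with
  | 0 => fun F a => 0
  | n'.+1 => fun F a =>
      \sum_(i < n'.+2) \sum_(j < n'.+2 | (i < j)%N)
        (-1) ^+ (i + j) *:
          F (cons_arg (lie (a i) (a j)) (drop_arg i (drop_arg j a)))
  end.

Definition coboundary (k : fieldType) (g : lieAlgType k) (M : lieModType g) n
    (F : cochain g M n) : cochain g M n.+1 :=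
  fun a => \sum_(i < n.+1) (-1) ^+ i *: act (a i) (F (drop_arg i a))
           + coboundary_bracket F a.

Definition is_cocycle (k : fieldType) (g : lieAlgType k) (M : lieModType g) n
    (F : cochain g M n) : Prop :=
  is_cochain F /\ coboundary F =1 (fun=> 0).

Definition is_coboundary (k : fieldType) (g : lieAlgType k) (M : lieModType g)
    n : cochain g M n -> Prop :=
  match n with
  | 0 => fun F => F =1 (fun=> 0)
  | n'.+1 => fun F =>
      exists2 G : cochain g M n', is_cochain G & coboundary G =1 F
  end.

(* The value 0 for n = 0 is a dummy: contraction is meant for n >= 1. *)
Definition contraction (k : fieldType) (g M : lmodType k) (x : g) n :
    cochain g M n -> cochain g M n.-1 :=
  match n with
  | 0 => fun F a => 0
  | n'.+1 => fun F a => F (cons_arg x a)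
  end.

Definition ad_end (k : fieldType) (g : finLieAlgType k) (x : g) : 'End(g) :=
  linfun (lie x).

Definition act_end (k : fieldType) (g : finLieAlgType k) (M : finLieModType g)
    (x : g) : 'End(M) :=
  linfun (act x).

Lemma ad_endE (k : fieldType) (g : finLieAlgType k) (x : g) :
  ad_end x =1 lie x.
Proof. exact: lfunE. Qed.

Lemma act_endE (k : fieldType) (g : finLieAlgType k) (M : finLieModType g)
    (x : g) :
  act_end M x =1 act x.
Proof. exact: lfunE. Qed.

Definition semisimple_end (k : fieldType) (V : vectType k) (f : 'End(V)) :
    Prop :=
  forall U : {vspace V}, (f @: U <= U)%VS ->
  exists W : {vspace V},
    [/\ (f @: W <= W)%VS, (U + W)%VS = fullv & (U :&: W)%VS = 0%VS].

Definition ad_semisimple (k : fieldType) (g : finLieAlgType k)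
    (M : finLieModType g) (s : g) : Prop :=
  semisimple_end (ad_end s) /\ semisimple_end (act_end M s).

(* "k contains the eigenvalues of f", without an algebraic closure of k: every
   eigenvalue of f in any field extension of k comes from k. *)
Definition contains_eigenvalues (k : fieldType) (V : vectType k)
    (f : 'End(V)) : Prop :=
  forall (L : fieldType) (iota : {rmorphism k -> L}) (l : L),
    eigenvalue (map_mx iota (mxof (vbasis {:V}) (vbasis {:V}) f)) l ->
  exists c : k, l = iota c.

Definition homogeneous (k : fieldType) (g : finLieAlgType k)
    (M : finLieModType g) (s : g) n (r : k) (F : cochain g M n) : Prop :=
  forall (lam : 'I_n -> k) (a : {ffun 'I_n -> g}),
    (forall i, a i \in leigenspace (ad_end s) (lam i)) ->
  F a \in leigenspace (act_end M s) (\sum_(i < n) lam i + r).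

(* Main.v *)
Require Import Defs.
From HB Require Import structures.
From mathcomp Require Import all_boot all_order all_algebra all_field.
From mathcomp Require Import zify.
From Stdlib Require Import Classical_Prop.

(** The Cartan formula [delta o iota_x + iota_x o delta = theta_x] holds,
    where [theta_x F a = [x, F a] - \sum_i F (.., [x, a_i], ..)].  As [sigma] is
    semisimple with all eigenvalues in [k], its eigenvectors span [g]; on
    eigenvectors, and hence by multilinearity everywhere, a cochain homogeneous
    of degree [r] satisfies [theta_sigma F = r F].  For a cocycle [F] this gives
    [delta (iota_sigma F) = r F]. *)

Set Implicit Arguments.
Unset Strict Implicit.
Unset Printing Implicit Defensive.

Import GRing.Theory passmx.
Local Open Scope ring_scope.

(** * Eigenvectors of semisimple endomorphisms *)

(** Induction on the degree: a root of a proper factor is a root of [p], and if [p] has no proper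
    factor, then it is irreducible and a root can be adjoined. The case split is classical, since
    irreducibility over an arbitrary field need not be decidable. *)
Lemma root_in_extension (k : fieldType) (p : {poly k}) : (1 < size p)%N ->
  exists (L : fieldType) (iota : {rmorphism k -> L}) (z : L),
    root (map_poly iota p) z.
Proof.
have [m] := ubnP (size p); elim: m p => // m IHm p /ltnSE le_pm p_gt1.
have p0 : p != 0 by rewrite -size_poly_gt0 ltnW.
have [[q [q1 qp npq]]|irr] :=
  classic (exists q : {poly k}, [/\ size q != 1, q %| p & ~~ (q %= p)]).
- have q0 : q != 0 by apply: contraNneq p0 => q0; rewrite q0 dvd0p in qp.
  have lt_qp : (size q < size p)%N.
    by rewrite ltn_neqAle dvdp_leq // andbT (dvdp_size_eqp qp).
  have q_gt1 : (1 < size q)%N by rewrite ltn_neqAle eq_sym q1 size_poly_gt0.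
  have [L [iota [z qz]]] := IHm q (leq_trans lt_qp le_pm) q_gt1.
  exists L, iota, z; move: qz; rewrite !root_factor_theorem => qz.
  by apply: dvdp_trans qz _; rewrite dvdp_map.
have irr_p : irreducible_poly p.
  split=> // q q1 qp; apply/negPn/negP => npq.
  by apply: irr; exists q.
have [L _ [z pz _]] := irredp_FAdjoin irr_p.
by exists L, (in_alg L), z.
Qed.

Lemma memv_leigenspace (k : fieldType) (V : vectType k) (f : 'End(V)) (a : k)
    (v : V) :
  (v \in leigenspace f a) = (f v == a *: v).
Proof.
by rewrite memv_ker add_lfunE opp_lfunE scale_lfunE id_lfunE subr_eq0.
Qed.

(* An eigenvalue of the restriction of [f] to [W] exists in some extension of
   [k]; being an eigenvalue of [f], it lies in [k]. *)
Lemma stable_has_eigenvector (k : fieldType) (V : vectType k) (f : 'End(V))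
    (W : {vspace V}) :
  contains_eigenvalues f -> (f @: W <= W)%VS -> W != 0%VS ->
  exists (c : k) (w : V), [/\ w \in W, w != 0 & f w = c *: w].
Proof.
move=> f_eig fW W0; set e := vbasis {:V}.
have e_basis : basis_of {:V} e := vbasisP _.
set A := mxof e e f; set B := row_base (msof e W).
(* The rows of [B] are coordinates of a basis of [W], so [C] is the matrix of the restriction of [f]
   to [W]; stability of [W] is what gives [C *m B = B *m A]. *)
set C := B *m A *m pinvmx B.
have BA : C *m B = B *m A.
  apply: mulmxKpV; apply/row_subP => i; rewrite row_mul eq_row_base.
  have: (row i B <= msof e W)%MS by rewrite -(eq_row_base (msof e W)) row_sub.
  rewrite -mem_vecof // => /(memv_img f)/(subvP fW).
  by rewrite -mem_vecof // (hom_vecof _ e_basis).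
have charC_gt1 : (1 < size (char_poly C))%N.
  by rewrite size_char_poly ltnS lt0n mxrank_eq0 msof_eq0.
have [L [iota [z Cz]]] := root_in_extension charC_gt1.
have [c zE] : exists c, z = iota c.
  apply: (f_eig L); move: Cz; rewrite map_char_poly -eigenvalue_root_char.
  (* [B] carries eigenvectors of [C] to eigenvectors of [A], and it kills none because its rows are
     free. *)
  case/eigenvalueP => v vC v0; apply/eigenvalueP; exists (v *m map_mx iota B).
    by rewrite -mulmxA -map_mxM -BA map_mxM mulmxA vC scalemxAl.
  by rewrite mulmx_free_eq0 // row_free_map row_base_free.
(* Now that [z] comes from [c], the root descends along [iota], and [C] has an eigenvector over [k]
   itself. *)
move: Cz; rewrite zE fmorph_root -eigenvalue_root_char.
case/eigenvalueP => v vC v0; exists c, (vecof e (v *m B)); split.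
- rewrite mem_vecof //; apply: (submx_trans (submxMl _ _)).
  by rewrite eq_row_base.
- by rewrite vecof_eq0 // mulmx_free_eq0 // row_base_free.
- by rewrite (hom_vecof _ e_basis) -mulmxA -BA mulmxA vC -scalemxAl linearZ.
Qed.

(** The span of the eigenvectors found so far is stable; while it is proper, its stable complement
    is nonzero and supplies an eigenvector outside the span. *)
Lemma semisimple_eigenvectors_span (k : fieldType) (V : vectType k)
    (f : 'End(V)) :
  semisimple_end f -> contains_eigenvalues f ->
  exists2 X : seq V, <<X>>%VS = fullv &
    forall x, x \in X -> exists c, x \in leigenspace f c.
Proof.
move=> f_ss f_eig.
(* [m] bounds the codimension of the span of [X], which drops with each new eigenvector. *)
suff extend m (X : seq V) : (\dim {:V} - \dim <<X>> <= m)%N ->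
    (forall x, x \in X -> exists c, x \in leigenspace f c) ->
    exists2 Y : seq V, <<Y>>%VS = fullv &
      forall x, x \in Y -> exists c, x \in leigenspace f c.
  by apply: (extend _ [::] (leqnn _)).
elim: m X => [|m IHm] X dimX X_eig.
  exists X => //; apply/eqP; rewrite eqEdim subvf /=.
  by rewrite leqn0 subn_eq0 in dimX.
have [/eqP X_full|X_nfull] := boolP (<<X>>%VS == fullv); first by exists X.
have X_stable : (f @: <<X>> <= <<X>>)%VS.
  apply/subvP => _ /memv_imgP[u uX ->].
  have -> := coord_span (uX : u \in <<in_tuple X>>%VS).
  rewrite linear_sum memv_suml // => i _; rewrite linearZ rpredZ //=.
  have Xi : X`_i \in X by rewrite mem_nth.
  have [c] := X_eig _ Xi; rewrite memv_leigenspace => /eqP ->.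
  by rewrite rpredZ // memv_span.
have [W [fW XW_full XW0]] := f_ss _ X_stable.
have W0 : W != 0%VS.
  by apply: contraNneq X_nfull => W0; rewrite -XW_full W0 addv0.
have [c [w [wW w0 fw]]] := stable_has_eigenvector f_eig fW W0.
apply: (IHm (w :: X)); last first.
  move=> x; rewrite inE => /predU1P[->|/X_eig //].
  by exists c; rewrite memv_leigenspace fw.
have lt_dim : (\dim <<X>> < \dim <<w :: X>>)%N.
  rewrite (ltn_leqif (dimv_leqif_sup _)) span_cons ?addvSr //.
  apply: contra w0 => wX; rewrite -memv0 -XW0 memv_cap wW andbT.
  exact/(subvP wX)/(subvP (addvSl _ _))/memv_line.
rewrite -ltnS; apply: leq_trans dimX.
by rewrite ltn_sub2l // (leq_trans lt_dim) ?dimvS ?subvf.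
Qed.

(** * Argument tuples and multilinear maps *)

Definition multilinear (k : fieldType) (g M : lmodType k) n
    (F : cochain g M n) : Prop :=
  forall (a : {ffun 'I_n -> g}) (i : 'I_n), linear (fun x => F (set_arg a i x)).

Section Arguments.

Variables (T : Type) (n : nat).
Implicit Types (a : {ffun 'I_n -> T}) (x y : T).

Lemma set_arg_id a i : set_arg a i (a i) = a.
Proof. by apply/ffunP => j; rewrite ffunE; case: eqP => [->|]. Qed.

Lemma set_arg_idem a i x y : set_arg (set_arg a i x) i y = set_arg a i y.
Proof. by apply/ffunP => j; rewrite !ffunE; case: eqP. Qed.

Lemma set_argC a i j x y : i != j ->
  set_arg (set_arg a i x) j y = set_arg (set_arg a j y) i x.
Proof.
move=> neq_ij; apply/ffunP => l; rewrite !ffunE.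
by case: (l =P j) => // ->; rewrite eq_sym (negPf neq_ij).
Qed.

Lemma cons_set_arg a i x y :
  cons_arg x (set_arg a i y) = set_arg (cons_arg x a) (lift ord0 i) y.
Proof.
apply/ffunP => j; rewrite !ffunE; case: unliftP => [j' ->|->].
  by rewrite ffunE (inj_eq lift_inj).
by rewrite (negPf (neq_lift _ _)).
Qed.

Lemma cons_arg0 a x : cons_arg x a ord0 = x.
Proof. by rewrite ffunE unlift_none. Qed.

Lemma cons_argS a x i : cons_arg x a (lift ord0 i) = a i.
Proof. by rewrite ffunE liftK. Qed.

End Arguments.

Lemma drop0_cons_arg (T : Type) n (a : {ffun 'I_n -> T}) x :
  drop_arg 0 (cons_arg x a) = a.
Proof.
apply/ffunP => j; rewrite ffunE -[RHS](cons_argS a x); congr (cons_arg x a _).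
by apply: val_inj; rewrite /= inordK // ltnS ltn_ord.
Qed.

Lemma bump_leq i j n : (j < n)%N -> (bump i j <= n)%N.
Proof. by rewrite /bump; case: (i <= j)%N => /=; lia. Qed.

Lemma dropS_cons_arg (T : Type) n (a : {ffun 'I_n.+1 -> T}) x i :
  drop_arg i.+1 (cons_arg x a) = cons_arg x (drop_arg i a).
Proof.
apply/ffunP => j; rewrite ffunE.
have [j' ->|->] := unliftP ord0 j.
  rewrite cons_argS [RHS]ffunE -(cons_argS a x); congr (cons_arg x a _).
  have le_bump : (bump i j' <= n)%N := bump_leq i (ltn_ord j').
  by apply: val_inj; rewrite /= -[bump 0 j']/j'.+1 bumpS !inordK ?ltnS.
rewrite cons_arg0 -[RHS](cons_arg0 a); congr (cons_arg x a _).
by apply: val_inj; rewrite /= inordK.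
Qed.

(* An alias of [F (set_arg a i x)] that carries a linear structure. *)
Definition arg_fun (k : fieldType) (g M : lmodType k) n (F : cochain g M n)
    (F_lin : multilinear F) (a : {ffun 'I_n -> g}) (i : 'I_n) (x : g) : M :=
  F (set_arg a i x).

HB.instance Definition _ (k : fieldType) (g M : lmodType k) n
    (F : cochain g M n) (F_lin : multilinear F) (a : {ffun 'I_n -> g})
    (i : 'I_n) :=
  GRing.isLinear.Build k g M *:%R (arg_fun F_lin a i) (F_lin a i).

(** The arguments are expanded over the spanning list one slot at a time. *)
Lemma multilinear_span_eq0 (k : fieldType) (g : vectType k) (M : lmodType k) n
    (F : cochain g M n) (X : seq g) :
  <<X>>%VS = fullv -> multilinear F ->
  (forall a : {ffun 'I_n -> g}, (forall i, a i \in X) -> F a = 0) ->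
  F =1 (fun=> 0).
Proof.
move=> X_full F_lin F_X.
(* Only the first [m] arguments are still arbitrary; the induction step expands the one of index [m]
   of these [m.+1]. *)
suff F0 m (a : {ffun 'I_n -> g}) : (m <= n)%N ->
    (forall i : 'I_n, (m <= i)%N -> a i \in X) -> F a = 0.
  by move=> a; apply: (F0 n) => // i; rewrite leqNgt ltn_ord.
elim: m a => [|m IHm] a le_mn aX; first by apply: F_X => i; apply: aX.
pose i := Ordinal le_mn; rewrite -(set_arg_id a i) -/(arg_fun F_lin a i (a i)).
have ai_X : a i \in <<in_tuple X>>%VS by rewrite X_full memvf.
rewrite (coord_span ai_X) linear_sum big1 // => j _.
rewrite linearZ /= /arg_fun IHm ?scaler0 1?ltnW // => l le_ml.
rewrite ffunE; case: eqP => [_|/eqP neq_li]; first by rewrite mem_nth.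
by apply: aX; rewrite ltn_neqAle le_ml andbT eq_sym.
Qed.

(** * Sign rules for alternating cochains *)

Section AlternatingCochains.

Variables (k : fieldType) (g M : lmodType k) (n : nat).
Implicit Types (x y : g) (a : {ffun 'I_n -> g}).

(** Polarization: expand the vanishing value of [F] with [x + y] in both slots. *)
Lemma cochain_swap (F : cochain g M n) a (i j : 'I_n) x y :
  is_cochain F -> i != j ->
  F (set_arg (set_arg a i x) j y) = - F (set_arg (set_arg a i y) j x).
Proof.
move=> [F_lin F_alt] neq_ij; have neq_ji : j != i by rewrite eq_sym.
have F_eq z : F (set_arg (set_arg a i z) j z) = 0.
  by apply: (F_alt _ i j) => //; rewrite !ffunE (negPf neq_ij) !eqxx.
have linl u v w : F (set_arg (set_arg a i (u + v)) j w) =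
    F (set_arg (set_arg a i u) j w) + F (set_arg (set_arg a i v) j w).
  rewrite !(set_argC _ _ _ neq_ij).
  exact: (linearD (arg_fun F_lin (set_arg a j w) i)).
have linr u v w : F (set_arg (set_arg a i w) j (u + v)) =
    F (set_arg (set_arg a i w) j u) + F (set_arg (set_arg a i w) j v).
  exact: (linearD (arg_fun F_lin (set_arg a i w) j)).
apply/eqP; rewrite -addr_eq0; apply/eqP.
by have := F_eq (x + y); rewrite linl !linr !F_eq add0r addr0.
Qed.

Lemma contraction_cochain (F : cochain g M n) x :
  is_cochain F -> is_cochain (contraction x F).
Proof.
case: n F => [|m] F [F_lin F_alt].
  by split=> [a []|a []].
split=> [a i|a i j neq_ij a_eq] /=.
  by move=> c u v; rewrite !cons_set_arg F_lin.
apply: (F_alt _ (lift ord0 i) (lift ord0 j)); last by rewrite !cons_argS.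
by rewrite (inj_eq lift_inj).
Qed.

End AlternatingCochains.

(** Moving [x] from the front to position [j] takes [j] adjacent transpositions. *)
Lemma cochain_cons_drop (k : fieldType) (g M : lmodType k) n
    (F : cochain g M n.+1) x (a : {ffun 'I_n.+1 -> g}) (j : 'I_n.+1) :
  is_cochain F ->
  F (cons_arg x (drop_arg j a)) = (-1) ^+ j *: F (set_arg a j x).
Proof.
move=> F_cochain; case: j => m lt_mn /=.
elim: m lt_mn a => [|m IHm] lt_mn a.
  rewrite scale1r; congr (F _); apply/ffunP => l; rewrite !ffunE.
  case: unliftP => [l' ->|->] //=; rewrite ffunE.
  by congr (a _); apply: val_inj; rewrite /= inordK // ltnS ltn_ord.
pose j1 := Ordinal lt_mn; pose j := Ordinal (ltnW lt_mn).
have neq_jj1 : j != j1 by rewrite -val_eqE /= neq_ltn ltnSn.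
(* Copying entry [m] into slot [m.+1] allows slot [m] to be dropped instead, so that the induction
   hypothesis applies; one swap of these two slots then accounts for the extra sign. *)
have -> : drop_arg m.+1 a = drop_arg m (set_arg a j1 (a j)).
  apply/ffunP => l; rewrite !ffunE -val_eqE /=.
  have le_bump i : (bump i l <= n)%N := bump_leq i (ltn_ord l).
  rewrite inordK ?ltnS //; case: eqP => [bumpE|bumpN].
    have lm : l = m :> nat by move: bumpE; rewrite /bump; lia.
    by congr (a _); apply: val_inj; rewrite /= inordK ?ltnS // /bump lm ltnn.
  by congr (a (inord _)); move: bumpN; rewrite /bump; lia.
rewrite (IHm (ltnW lt_mn)) -/j exprS mulN1r scaleNr -scalerN; congr (_ *: _).
by rewrite -set_argC // cochain_swap // set_arg_id.
Qed.

Lemma cochain_consC (k : fieldType) (g M : lmodType k) n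
    (F : cochain g M n.+2) x y (b : {ffun 'I_n -> g}) :
  is_cochain F ->
  F (cons_arg y (cons_arg x b)) = - F (cons_arg x (cons_arg y b)).
Proof.
move=> F_cochain; set c := cons_arg x (cons_arg y b).
(* With [c] = (x, y, b), this reduces the exchange to the preceding sign rule at position 1. *)
have dropE : cons_arg x b = drop_arg 1 c.
  by rewrite dropS_cons_arg drop0_cons_arg.
have c1 : c (lift ord0 ord0) = y by rewrite cons_argS cons_arg0.
rewrite dropE (@cochain_cons_drop _ _ _ _ _ _ c (lift ord0 ord0)) //.
by rewrite expr1 scaleN1r -[X in set_arg c _ X]c1 set_arg_id.
Qed.

(** * The Cartan formula *)

Section Cartan.

Variables (k : fieldType) (g : lieAlgType k) (M : lieModType g).

Definition lie_derivative n (x : g) (F : cochain g M n) : cochain g M n :=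
  fun a => act x (F a) - \sum_(i < n) F (set_arg a i (lie x (a i))).

(** This is the Cartan formula in degree 0, where there is no contraction term. *)
Lemma coboundary0 (F : cochain g M 0) x a :
  coboundary F (cons_arg x a) = lie_derivative x F a.
Proof.
rewrite /coboundary /lie_derivative /= big_ord_recl !big_ord0 scale1r subr0.
by rewrite !addr0 drop0_cons_arg cons_arg0.
Qed.

(** Pairs that involve the leading [x] produce the brackets [lie x (a i)]; the remaining pairs
    produce the bracket part for the contraction. *)
Lemma bracket_contraction n (F : cochain g M n.+1) x (a : {ffun 'I_n.+1 -> g}) :
  is_cochain F ->
  coboundary_bracket F (cons_arg x a) =
    - coboundary_bracket (contraction x F) a
    - \sum_(i < n.+1) F (set_arg a i (lie x (a i))).
Proof.
move=> F_cochain; rewrite /= big_ord_recl addrC; congr (_ + _); last first.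
  rewrite -sumrN big_mkcond big_ord_recl /= add0r; apply: eq_bigr => j _ /=.
  rewrite cons_arg0 cons_argS /bump leq0n add1n add0n exprS mulN1r scaleNr.
  rewrite dropS_cons_arg drop0_cons_arg cochain_cons_drop // scalerA -expr2.
  by rewrite sqrr_sign scale1r.
(* For a 1-cochain both sides vanish: the contraction has degree 0, and no pair of indices
   remains. *)
case: n F F_cochain a => [|n] F F_cochain a.
  rewrite oppr0 big1 // => i _; rewrite big_pred0 // => j.
  by rewrite ltnNge -ltnS (leq_trans (ltn_ord j)).
(* Both indices shift by one, so the sign of each term is unchanged; the minus comes from exchanging
   [x] with the bracket in front of it. *)
rewrite -sumrN; apply: eq_bigr => i _; rewrite -sumrN.
rewrite big_mkcond big_ord_recl /= add0r -big_mkcond.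
apply: eq_big => [j|j lt_ij]; first by rewrite /bump /= !add1n ltnS.
rewrite !cons_argS /bump /= !add1n addSn addnS !exprS !mulN1r opprK -scalerN.
by rewrite !dropS_cons_arg (cochain_consC x).
Qed.

(** In the action sum the term of index 0 is [act x (F a)], and the index shift negates the
    others. *)
Lemma cartan_formula n (F : cochain g M n.+1) x (a : {ffun 'I_n.+1 -> g}) :
  is_cochain F ->
  coboundary F (cons_arg x a) =
    lie_derivative x F a - coboundary (contraction x F) a.
Proof.
move=> F_cochain; rewrite /coboundary bracket_contraction // big_ord_recl.
rewrite cons_arg0 drop0_cons_arg scale1r /lie_derivative opprD -!addrA.
congr (_ + _); rewrite addrCA [RHS]addrC -!addrA addrC -!addrA.
congr (_ + _); last exact: addrC.
rewrite -[in RHS]sumrN; apply: eq_bigr => i _.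
by rewrite cons_argS dropS_cons_arg lift0 exprS mulN1r scaleNr.
Qed.

End Cartan.

(** * The Lie derivative of a homogeneous cochain *)

Lemma lie_derivative_multilinear (k : fieldType) (g : lieAlgType k)
    (M : lieModType g) n (x : g) (F : cochain g M n) :
  multilinear F -> multilinear (lie_derivative x F).
Proof.
move=> F_lin a i c u v; rewrite /lie_derivative F_lin linearP /= scalerBr.
rewrite addrACA -opprD; congr (_ - _); rewrite scaler_sumr -big_split /=.
(* For [j = i] linearity passes through [lie x]; for [j] distinct from [i] the two substitutions
   commute. *)
apply: eq_bigr => j _; have [<-|neq_ij] := eqVneq i j.
  by rewrite !ffunE eqxx !set_arg_idem linearP F_lin.
by rewrite !ffunE eq_sym (negPf neq_ij) !(set_argC _ _ _ neq_ij) F_lin.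
Qed.

Lemma lie_derivative_homogeneous (k : fieldType) (g : finLieAlgType k)
    (M : finLieModType g) (s : g) n (r : k) (F : cochain g M n) :
  semisimple_end (ad_end s) -> contains_eigenvalues (ad_end s) ->
  multilinear F -> homogeneous s r F ->
  lie_derivative s F =1 (fun a => r *: F a).
Proof.
move=> s_ss s_eig F_lin F_homog.
have [X X_full X_eig] := semisimple_eigenvectors_span s_ss s_eig.
pose D a := lie_derivative s F a - r *: F a.
suff D0 : D =1 (fun=> 0).
  by move=> a; apply/eqP; rewrite -subr_eq0 [X in X == _]D0.
apply: (multilinear_span_eq0 X_full) => [a i c u v|a aX].
  rewrite /D lie_derivative_multilinear // F_lin.
  rewrite [r *: (_ + _)]scalerDr [c *: (_ - r *: _)]scalerBr opprD.
  by rewrite addrACA !scalerA [r * c]mulrC.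
have [lam a_eig] : exists lam : 'I_n -> k,
    forall i, a i \in leigenspace (ad_end s) (lam i).
  exact: (fin_all_exists (fun i => X_eig _ (aX i))).
have := F_homog _ _ a_eig; rewrite memv_leigenspace act_endE => /eqP sF.
(* The action of [s] contributes the sum of the [lam i] plus [r], and substitution in slot [i] takes
   away [lam i], leaving [r]. *)
rewrite /D /lie_derivative sF scalerDl addrAC addrK scaler_suml.
apply/eqP; rewrite subr_eq0; apply/eqP; apply: eq_bigr => i _.
have := a_eig i; rewrite memv_leigenspace ad_endE => /eqP ->.
rewrite -/(arg_fun F_lin a i (lam i *: a i)) linearZ /=.
by rewrite /arg_fun set_arg_id.
Qed.

(** * Rescaling cochains, and the conclusion *)

Lemma coboundaryZ (k : fieldType) (g : lieAlgType k) (M : lieModType g) n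
    (c : k) (F : cochain g M n) a :
  coboundary (fun b => c *: F b) a = c *: coboundary F a.
Proof.
rewrite /coboundary scalerDr scaler_sumr; congr (_ + _).
  by apply: eq_bigr => i _; rewrite linearZ !scalerA mulrC.
case: n F a => [|n] F a; first by rewrite /= scaler0.
rewrite /= scaler_sumr; apply: eq_bigr => i _.
by rewrite scaler_sumr; apply: eq_bigr => j _; rewrite !scalerA mulrC.
Qed.

Lemma is_cochainZ (k : fieldType) (g M : lmodType k) n (c : k)
    (F : cochain g M n) :
  is_cochain F -> is_cochain (fun a => c *: F a).
Proof.
move=> [F_lin F_alt]; split=> [a i d u v|a i j neq_ij a_eq].
  by rewrite F_lin scalerDr !scalerA mulrC.
by rewrite (F_alt a i j) ?scaler0.
Qed.

Theorem theorem1 (k : fieldType) (g : finLieAlgType k) (M : finLieModType g)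
    (sigma : g) (n : nat) (r : k) (F : cochain g M n) :
  ad_semisimple M sigma ->
  contains_eigenvalues (ad_end sigma) ->
  contains_eigenvalues (act_end M sigma) ->
  is_cocycle F ->
  homogeneous sigma r F ->
  (r != 0 -> is_coboundary F) /\
  (r = 0 -> (1 <= n)%N -> is_cocycle (contraction sigma F)).
Proof.
move=> [ad_ss _] ad_eig _ [F_cochain dF] F_homog.
have LF := lie_derivative_homogeneous ad_ss ad_eig F_cochain.1 F_homog.
case: n F F_cochain dF {F_homog} LF => [|n] F F_cochain dF LF.
  (* In degree 0 the only coboundary is 0, and [r *: F a] is a value of the coboundary of [F], hence
     zero. *)
  split=> // r0 a /=; apply: (scalerI r0).
  by rewrite -LF -(coboundary0 F) dF scaler0.
have diF a : coboundary (contraction sigma F) a = r *: F a.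
  have := cartan_formula sigma a F_cochain; rewrite dF LF => /esym/eqP.
  by rewrite subr_eq0 => /eqP.
split=> [r0|r0 _].
(* The primitive is read off from [diF] by dividing by [r]. *)
- exists (fun a => r^-1 *: contraction sigma F a).
    exact: is_cochainZ (contraction_cochain sigma F_cochain).
  by move=> a; rewrite coboundaryZ diF scalerA mulVf // scale1r.
- split=> [|a]; first exact: contraction_cochain.
  by rewrite diF r0 scale0r.
Qed.
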